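(* Let $r \ge 2$ and let $X \subset \mathbb{P}^r$ be a smooth connected complete intersection defined over $\mathbb{F}_q$. Let $m \ge 0$ be an integer and let $G$ be a divisor on $X$ such that $L(G) \supseteq H^0(\mathbb{P}^r, \mathcal{O}_{\mathbb{P}^r}(m))$, i.e. $L(G)$ contains the restrictions to $X$ of all polynomials of degree at most $m$ in the affine coordinates $x_1,\dots,x_r$ of an affine chart $\mathbb{A}^r \subset \mathbb{P}^r$. Let $P_1, \ldots, P_n$ be distinct $\mathbb{F}_q$-rational points of $X$ lying in this affine chart and not in the support of $G$, and let $D := P_1 + \cdots + P_n$. Let $d$ be the minimum distance of the code $C(D,G)^*$, let $c$ be a codeword of weight $d$, and let $\{P_{i_1}, \ldots, P_{i_d}\}$ be the points $P_i$ for which $c_i \neq 0$. Then: (i) If $d \le m+2$, then $d = m+2$ and the $m+2$ points $P_{i_j}$ are collinear in $\mathbb{P}^r$. (ii) If $d \le 2m+2$ and no $m+2$ of the points $P_{i_j}$ are collinear, then $d = 2m+2$ and all the $2m+2$ points $P_{i_j}$ lie on a conic contained in a plane of $\mathbb{P}^r$. (iii) If $d \le 3m$, no $m+2$ of the points $P_{i_j}$ are collinear and no $2m+2$ of them lie on a plane conic, then $d = 3m$ and there exist a plane $\Pi \subset \mathbb{P}^r$ and two curves $C_3, C_m \subset \Pi$ of respective degrees $3$ and $m$ such that all the $3m$ points $P_{i_j}$ lie in $C_3 \cap C_m$.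
   Context: For a divisor $G$ on $X$, $L(G)$ denotes the Riemann–Roch space of rational functions $f$ on $X$ with $f = 0$ or $\mathrm{div}(f) + G \ge 0$. For $D = P_1+\cdots+P_n$ with the $P_i$ outside the support of $G$, $C(D,G)$ is the evaluation code $\{(f(P_1),\ldots,f(P_n)) : f \in L(G)\} \subseteq \mathbb{F}_q^n$, and $C(D,G)^*$ is its dual code, i.e. the set of $c \in \mathbb{F}_q^n$ with $\sum_{i=1}^n c_i f(P_i) = 0$ for all $f \in L(G)$. The weight of a codeword is its number of nonzero coordinates, and the minimum distance is the minimum weight of a nonzero codeword. *)

(* Defs.v *)
From HB Require Import structures.
From mathcomp Require Import all_boot all_order all_algebra.
From mathcomp Require Import mpoly.
Set Implicit Arguments. Unset Strict Implicit. Unset Printing Implicit Defensive.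
Import GRing.Theory.
Local Open Scope ring_scope.

Section Defs.
Variables (F : fieldType) (r n : nat).

Definition ev_poly (P : 'I_n -> 'rV[F]_r) (p : {mpoly F[r]}) : 'rV[F]_n :=
  \row_i p.@[fun k => P i 0 k].

Definition in_dual (C : {vspace 'rV[F]_n}) (c : 'rV[F]_n) : Prop :=
  forall x, x \in C -> \sum_(i < n) c 0 i * x 0 i = 0.

Definition supp (c : 'rV[F]_n) : {set 'I_n} := [set i | c 0 i != 0].

Definition weight (c : 'rV[F]_n) : nat := #|supp c|.

(* the points P_i, i in S, lie on a line of A^r (equivalently, since they are
   affine points, on a line of P^r) *)
Definition collinear (P : 'I_n -> 'rV[F]_r) (S : {set 'I_n}) : Prop :=
  exists (a b : 'rV[F]_r), b != 0 /\
    forall i, i \in S -> exists t : F, P i = a + t *: b.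

Definition pt2 (s t : F) : 'I_2 -> F := fun j => if val j == 0%N then s else t.

(* the points P_i, i in S, lie on a plane curve of degree k: there is an affine
   plane a + F u + F v (u, v independent) and a nonzero polynomial f of total
   degree <= k in the plane coordinates vanishing at all the points
   (= affine part of a projective plane curve of degree k). *)
Definition on_plane_curve (P : 'I_n -> 'rV[F]_r) (k : nat) (S : {set 'I_n}) : Prop :=
  exists (a u v : 'rV[F]_r), \rank (col_mx u v) = 2%N /\
  exists f : {mpoly F[2]}, f != 0 /\ (msize f <= k.+1)%N /\
    forall i, i \in S -> exists s t : F,
      P i = a + s *: u + t *: v /\ f.@[pt2 s t] = 0.

Definition on_plane_curves2 (P : 'I_n -> 'rV[F]_r) (k1 k2 : nat)
    (S : {set 'I_n}) : Prop :=
  exists (a u v : 'rV[F]_r), \rank (col_mx u v) = 2%N /\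
  exists f g : {mpoly F[2]}, f != 0 /\ g != 0 /\
    (msize f <= k1.+1)%N /\ (msize g <= k2.+1)%N /\
    forall i, i \in S -> exists s t : F,
      P i = a + s *: u + t *: v /\ f.@[pt2 s t] = 0 /\ g.@[pt2 s t] = 0.

End Defs.

(* Main.v *)
Require Import Defs.
From HB Require Import structures.
From mathcomp Require Import all_boot all_order all_algebra.
From mathcomp Require Import mpoly zify.
Import GRing.Theory.
Local Open Scope ring_scope.

Set Implicit Arguments.
Unset Strict Implicit.
Unset Printing Implicit Defensive.

(** The codeword c is a linear relation, with all coefficients nonzero on its
    support, between the evaluations at the points of all polynomials of degree
    at most m.  Multiplying c by the values of a polynomial of degree e gives a
    relation of degree m - e supported on the points off that hypersurface
    (residuation).  Cutting by a hyperplane through as many points as possible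
    and inducting on m shows that supports of size at most 2m + 1 are collinear,
    and that supports of size at most 3m + 1 are coplanar or contain m + 2
    collinear points.  In the plane, residuation by lines and by conics through
    five points settles size 2m + 2.  For size at most 3m let h be the Hilbert
    function of the support.  Residuation gives h(k) + h(m - k) <= d, the
    induction hypothesis bounds h(m - 1) from below, and the first difference
    of h is nonincreasing once it drops below its generic value; for d < 3m,
    or for d = 3m off a cubic, these are incompatible.  Since (i) and (ii)
    exclude m <= 2 in case (iii), the cubic itself serves as curve of degree
    m. *)

(** * Relations and residuation *)

Section Relations.
Variables (F : fieldType) (r n : nat) (P : 'I_n -> 'rV[F]_r).
Implicit Types (c : 'rV[F]_n) (p q : {mpoly F[r]}) (S T : {set 'I_n}).

Definition ev p i : F := p.@[fun k => P i 0 k].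

(** Injectivity is asked only on the support, so that the notion survives passage to plane
    coordinates, which separate only points of the plane. *)
Definition relation (m : nat) c : Prop :=
  {in supp c &, injective P} /\
  forall p, (msize p <= m.+1)%N -> \sum_i c 0 i * ev p i = 0.

Definition zeros p : {set 'I_n} := [set i | ev p i == 0].

Definition twist c p : 'rV[F]_n := \row_i (c 0 i * ev p i).

Lemma msizeM_leq e1 e2 p q :
  (msize p <= e1.+1)%N -> (msize q <= e2.+1)%N ->
  (msize (p * q) <= (e1 + e2).+1)%N.
Proof.
have [->|p0] := eqVneq p 0; first by rewrite mul0r msize0.
have [->|q0] := eqVneq q 0; first by rewrite mulr0 msize0.
move=> hp hq; rewrite msizeM // -subn1 leq_subLR.
by apply: leq_trans (leq_add hp hq) _; rewrite addSn addnS.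
Qed.

Lemma evM p q i : ev (p * q) i = ev p i * ev q i.
Proof. by rewrite /ev mevalM. Qed.

Lemma zerosM p q : zeros (p * q) = zeros p :|: zeros q.
Proof. by apply/setP=> i; rewrite !inE evM mulf_eq0. Qed.

Lemma supp_eq0 c : (supp c == set0) = (c == 0).
Proof.
apply/eqP/eqP => [h|->]; last by apply/setP=> i; rewrite !inE mxE eqxx.
apply/rowP=> i; rewrite mxE; apply/eqP; move/setP/(_ i): h.
by rewrite !inE => /negbFE.
Qed.

Lemma supp_twist c p : supp (twist c p) = supp c :\: zeros p.
Proof. by apply/setP=> i; rewrite !inE mxE mulf_eq0 negb_or andbC. Qed.

Lemma supp_twist_sub c p : supp (twist c p) \subset supp c.
Proof. by rewrite supp_twist subsetDl. Qed.

Lemma card_twist c p :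
  #|supp c| = (#|supp c :&: zeros p| + #|supp (twist c p)|)%N.
Proof. by rewrite supp_twist cardsID. Qed.

Lemma twist_eq0 c p : (twist c p == 0) = (supp c \subset zeros p).
Proof. by rewrite -supp_eq0 supp_twist setD_eq0. Qed.

Lemma relation_twist e m c p :
  (msize p <= e.+1)%N -> relation (e + m) c -> relation m (twist c p).
Proof.
move=> hp [inj h]; split.
  by move=> i j hi hj; apply: inj; apply: (subsetP (supp_twist_sub c p)).
move=> q hq; rewrite -[RHS](h (p * q) (msizeM_leq hp hq)).
by apply: eq_bigr => i _; rewrite mxE evM mulrA.
Qed.

Lemma relationW m m' c : (m' <= m)%N -> relation m c -> relation m' c.
Proof.
by move=> hm [inj h]; split=> // p hp; apply: h; apply: leq_trans hp _.
Qed.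

(** Homogeneous coordinates with first entry 1. In the ranks below, 2 thus means a line and 3 a
    plane. *)
Definition hpt i : 'rV[F]_(1 + r) := row_mx 1%:M (P i).

Definition hspan S : 'M[F]_(1 + r) := (\sum_(i in S) <<hpt i>>)%MS.

Definition rk S : nat := \rank (hspan S).

Lemma hpt_hspan i S : i \in S -> (hpt i <= hspan S)%MS.
Proof. by move=> iS; apply: (sumsmx_sup i); rewrite ?genmxE. Qed.

Lemma hspan_subP m S (A : 'M_(m, _)) :
  reflect (forall i, i \in S -> (hpt i <= A)%MS) (hspan S <= A)%MS.
Proof.
by apply: (iffP sumsmx_subP) => h i /h; rewrite genmxE.
Qed.

Lemma hspanS S T : S \subset T -> (hspan S <= hspan T)%MS.
Proof. by move=> /subsetP st; apply/hspan_subP=> i /st; apply: hpt_hspan. Qed.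

Lemma rkS S T : S \subset T -> (rk S <= rk T)%N.
Proof. by move=> st; apply: mxrankS; apply: hspanS. Qed.

Lemma hspanU S T : (hspan (S :|: T) :=: hspan S + hspan T)%MS.
Proof.
apply/eqmxP; rewrite addsmx_sub !hspanS ?subsetUl ?subsetUr // !andbT.
apply/hspan_subP=> i; rewrite inE => /orP[] /hpt_hspan h.
  by apply: submx_trans h _; apply: addsmxSl.
by apply: submx_trans h _; apply: addsmxSr.
Qed.

Lemma rk0 : rk set0 = 0%N.
Proof. by rewrite /rk /hspan big_set0 mxrank0. Qed.

Lemma rk1 i : (rk [set i] <= 1)%N.
Proof. by rewrite /rk /hspan big_set1 genmxE rank_leq_row. Qed.

Lemma rkU_cap S T : (rk (S :|: T) + rk (S :&: T) <= rk S + rk T)%N.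
Proof.
rewrite /rk hspanU -[leqRHS]mxrank_sum_cap leq_add2l mxrankS //.
by rewrite sub_capmx !hspanS ?subsetIl ?subsetIr.
Qed.

Lemma rkU S T : (rk (S :|: T) <= rk S + rk T)%N.
Proof. by apply: leq_trans (rkU_cap S T); apply: leq_addr. Qed.

Lemma rk_card S : (rk S <= #|S|)%N.
Proof.
elim: {S}_.+1 {-2}S (ltnSn #|S|) => // k ih S hk.
have [->|[i iS]] := set_0Vmem S; first by rewrite rk0.
rewrite (cardsD1 i) iS -{1}(setD1K iS); apply: leq_trans (rkU _ _) _.
by apply: leq_add; [apply: rk1 | apply: ih; move: hk; rewrite (cardsD1 i) iS].
Qed.

Lemma rk_gt1 S i j : i \in S -> j \in S -> P i != P j -> (1 < rk S)%N.
Proof.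
move=> iS jS ne; rewrite ltnNge; apply: contra ne => hr.
have h0 : hpt i != 0.
  apply/eqP=> /(congr1 (@lsubmx F 1 1 r))/matrixP/(_ 0 0).
  by rewrite row_mxKl !mxE eqxx; apply/eqP; rewrite oner_eq0.
have hS : (hpt j <= hpt i)%MS.
  apply: submx_trans (hpt_hspan jS) _.
  have [_] := mxrank_leqif_sup (hpt_hspan iS); rewrite rank_rV h0 => <-.
  by have := mxrankS (hpt_hspan iS); rewrite rank_rV h0 eqn_leq hr andbT.
case/submxP: hS => D hD.
have /matrixP/(_ 0 0) := congr1 (@lsubmx F 1 1 r) hD.
rewrite mul_mx_row !row_mxKl mulmx1 !mxE eqxx => hD1.
have := congr1 (@rsubmx F 1 1 r) hD.
rewrite mul_mx_row !row_mxKr [D]mx11_scalar -hD1 mul_scalar_mx scale1r => ->.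
exact: eqxx.
Qed.

Definition linpoly (w : 'cV[F]_(1 + r)) : {mpoly F[r]} :=
  (w (lshift r 0) 0)%:MP + \sum_k w (rshift 1 k) 0 *: 'X_k.

Lemma msize_linpoly w : (msize (linpoly w) <= 2)%N.
Proof.
apply: leq_trans (msizeD_le _ _) _; rewrite geq_max.
apply/andP; split; first by rewrite msizeC; case: (_ == 0).
apply: leq_trans (msize_sum _ _ _) _; apply/bigmax_leqP=> k _.
by apply: leq_trans (msizeZ_le _ _) _; rewrite msizeX mdeg1.
Qed.

Lemma meval_linpoly w (x : 'rV[F]_r) :
  (linpoly w).@[fun k => x 0 k] = ((row_mx 1%:M x : 'rV_(1 + r)) *m w) 0 0.
Proof.
rewrite mevalD mevalC raddf_sum /= mxE big_split_ord /= big_ord1.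
rewrite row_mxEl mxE eqxx mul1r; congr (_ + _); apply: eq_bigr => k _.
by rewrite mevalZ mevalXU row_mxEr mulrC.
Qed.

Lemma linpoly_neq0 w : w != 0 -> linpoly w != 0.
Proof.
apply: contra => /eqP h0.
have hx (x : 'rV[F]_r) : ((row_mx 1%:M x : 'rV_(1 + r)) *m w) 0 0 = 0.
  by rewrite -meval_linpoly h0 meval0.
have e0 : w (lshift r 0) 0 = 0.
  rewrite -(hx 0) mxE big_split_ord /= big_ord1 row_mxEl mxE eqxx mul1r.
  by rewrite big1 ?addr0 // => k _; rewrite row_mxEr mxE mul0r.
apply/eqP/colP=> i; rewrite mxE.
have [j ->|k ->] := split_ordP i; first by rewrite ord1.
rewrite -(hx (delta_mx 0 k)) mxE big_split_ord /= big_ord1 e0 mulr0 add0r.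
rewrite (bigD1 k) //= row_mxEr mxE !eqxx mul1r big1 ?addr0 // => l hl.
by rewrite row_mxEr mxE (negPf hl) andbF mul0r.
Qed.

(** The columns of the cokernel matrix of the span are equations of hyperplanes through [S]; a point
    outside the span violates one of them. *)
Lemma exists_hyperplane S i : ~~ (hpt i <= hspan S)%MS ->
  exists p, [/\ (msize p <= 2)%N, S \subset zeros p & i \notin zeros p].
Proof.
rewrite submxE => /matrix0Pn[j [k hk]].
have ej (l : 'I_n) : ev (linpoly (col k (cokermx (hspan S)))) l
    = (hpt l *m cokermx (hspan S)) 0 k.
  rewrite /ev meval_linpoly !mxE; apply: eq_bigr => a _.
  by rewrite !mxE.
exists (linpoly (col k (cokermx (hspan S)))); split; first exact: msize_linpoly.
  apply/subsetP=> l /hpt_hspan; rewrite inE ej submxE => /eqP ->.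
  by rewrite mxE.
by rewrite inE ej; move: hk; rewrite ord1.
Qed.

Lemma separating_hyperplane S T : (rk S < rk T)%N ->
  exists i p, [/\ i \in T, (msize p <= 2)%N, S \subset zeros p & i \notin zeros p].
Proof.
move=> h; have [/hspan_subP hs|/sumsmx_subP h1] := boolP (hspan T <= hspan S)%MS.
  suff : (rk T <= rk S)%N by lia.
  by apply: mxrankS; apply/hspan_subP.
have /exists_inP[i iT hi] : [exists i in T, ~~ (hpt i <= hspan S)%MS].
  apply: contraT => /exists_inPn h2; case: h1 => i iT.
  by have := h2 i iT; rewrite negbK genmxE.
by have [p [? ? ?]] := exists_hyperplane hi; exists i, p.
Qed.

(** By induction: a hyperplane through one support point that misses another removes at least one
    point and leaves a nonzero relation of degree one less. *)
Lemma relation_card m c : relation m c -> c != 0 -> (m + 2 <= #|supp c|)%N.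
Proof.
elim: m c => [|m ih] c hc c0.
  have [_ h] := hc; rewrite ltnNge; apply/negP => h1.
  have [i ci] : exists i, i \in supp c.
    by apply/set0Pn; rewrite supp_eq0.
  (* Testing against the constant 1: if [i] were the only support point, its coefficient would
     vanish. *)
  have := h 1; rewrite msize1 => /(_ isT).
  rewrite (bigD1 i) //= /ev meval1 mulr1 big1 ?addr0 => [|j ji].
    by move/eqP; move: ci; rewrite inE => /negPf ->.
  have : j \notin supp c.
    apply: contraL h1 => cj; rewrite -ltnNge (cardsD1 i) ci ltnS.
    by apply/card_gt0P; exists j; rewrite !inE ji; move: cj; rewrite inE.
  by rewrite inE negbK => /eqP ->; rewrite mul0r.
have [i ci] : exists i, i \in supp c by apply/set0Pn; rewrite supp_eq0.
have h2 := ih _ (relationW (leqnSn m) hc) c0.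
have [j cj ji] : exists2 j, j \in supp c & j != i.
  have : (0 < #|supp c :\ i|)%N by move: h2; rewrite (cardsD1 i) ci; lia.
  by case/card_gt0P=> j; rewrite !inE => /andP[ji cj]; exists j; rewrite ?inE.
have : (rk [set i] < rk (supp c))%N.
  apply: leq_ltn_trans (rk1 i) _; apply: (rk_gt1 ci cj).
  by apply: contra ji => /eqP; move/(hc.1 _ _ ci cj) => ->.
case/separating_hyperplane=> k [p [kc hp sp kp]].
have := ih _ (relation_twist (e := 1) hp hc).
rewrite twist_eq0 (card_twist c p) => h3.
have : (0 < #|supp c :&: zeros p|)%N.
  by apply/card_gt0P; exists i; rewrite inE ci (subsetP sp) ?inE.
suff : ~~ (supp c \subset zeros p) by move/h3; lia.
by apply/subsetPn; exists k.
Qed.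

End Relations.

(** * Collinear and coplanar supports *)

Lemma exists_subset_card (T : finType) (S : {set T}) k :
  (k <= #|S|)%N -> exists2 U : {set T}, U \subset S & #|U| = k.
Proof.
move=> hk; exists [set x in take k (enum S)].
  by apply/subsetP=> x; rewrite inE => /mem_take; rewrite mem_enum.
rewrite cardsE; move/card_uniqP: (take_uniq k (enum_uniq (mem S))) => ->.
by rewrite size_take -cardE; case: ltngtP hk.
Qed.

Section Lines.
Variables (F : fieldType) (r n : nat) (P : 'I_n -> 'rV[F]_r).
Implicit Types (c : 'rV[F]_n) (p q : {mpoly F[r]}) (S T : {set 'I_n}).
Local Notation rk := (rk P).
Local Notation zeros := (zeros P).
Local Notation twist := (twist P).
Local Notation relation := (relation P).

Definition has_line k c : bool :=
  [exists S : {set 'I_n}, [&& S \subset supp c, (rk S <= 2)%N & (k <= #|S|)%N]].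

Lemma has_lineP k c :
  reflect (exists S, [/\ S \subset supp c, (rk S <= 2)%N & (k <= #|S|)%N])
          (has_line k c).
Proof.
apply: (iffP existsP) => -[S].
  by case/and3P=> ? ? ?; exists S.
by case=> ? ? ?; exists S; apply/and3P.
Qed.

Lemma has_lineW k c c' : supp c' \subset supp c -> has_line k c' -> has_line k c.
Proof.
move=> sc /has_lineP[S [sS h1 h2]]; apply/has_lineP; exists S; split=> //.
exact: subset_trans sc.
Qed.

Lemma card_twist_zeros c p S : S \subset supp c -> S \subset zeros p ->
  (#|S| + #|supp (twist c p)| <= #|supp c|)%N.
Proof.
move=> h1 h2; rewrite (card_twist P c p) leq_add2r subset_leq_card //.
by rewrite subsetI h1.
Qed.

Lemma twist_neq0 c p i : i \in supp c -> i \notin zeros p -> twist c p != 0.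
Proof. by move=> h1 h2; rewrite twist_eq0; apply/subsetPn; exists i. Qed.

Lemma exists_max_card (Q : pred {set 'I_n}) S0 : Q S0 ->
  exists2 S, Q S & forall T, Q T -> (#|T| <= #|S|)%N.
Proof.
by move=> h; case: (arg_maxnP (fun S : {set 'I_n} => #|S|) h) => S hS hm; exists S.
Qed.

(** Otherwise cut by a hyperplane through a largest collinear subset [L]. In degree m + 1 the
    residual has at most 2m + 1 points, so it is collinear and has at least m + 2 points. By
    maximality so does [L], which makes 2m + 4 points in all, too many. *)
Lemma relation_collinear m c :
  relation m c -> (#|supp c| <= 2 * m + 1)%N -> (rk (supp c) <= 2)%N.
Proof.
elim: m c => [|m ih] c hc hn.
  by apply: leq_trans (rk_card _ _) _; lia.
rewrite leqNgt; apply/negP=> h3.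
pose Q := [pred S : {set 'I_n} | (S \subset supp c) && (rk S <= 2)%N].
have [|L /andP[Ls L2] Lmax] := @exists_max_card Q set0.
  by rewrite /= sub0set rk0.
have L2' : (2 <= #|L|)%N.
  have [|T Ts T2] := @exists_subset_card _ (supp c) 2.
    by apply: ltnW; apply: leq_trans h3 (rk_card _ _).
  rewrite -T2 Lmax // /Q /= Ts /=; apply: leq_trans (rk_card _ _) _; lia.
have [|i [p [ic hp Lp ip]]] := @separating_hyperplane _ _ _ P L (supp c).
  exact: leq_ltn_trans h3.
have hc' := relation_twist (e := 1) (m := m) hp hc.
have h4 := card_twist_zeros Ls Lp.
have h5 := relation_card hc' (twist_neq0 ic ip).
have h6 : (rk (supp (twist c p)) <= 2)%N by apply: ih hc' _; lia.
have /Lmax : Q (supp (twist c p)) by rewrite /= supp_twist_sub h6.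
lia.
Qed.

Lemma relation_has_line m c : relation m c -> c != 0 ->
  (#|supp c| <= 2 * m + 1)%N -> has_line (m + 2) c.
Proof.
move=> hc c0 hn; apply/has_lineP; exists (supp c); split=> //.
  exact: relation_collinear hc hn.
exact: relation_card hc c0.
Qed.

(** Cut by a hyperplane through a largest coplanar subset. A coplanar residual is at most half of
    the support, hence small enough to be collinear. The line obtained is one point short of the m +
    3 wanted in degree m + 1. *)
Lemma relation_long_line m c : relation m.+1 c -> (#|supp c| <= 3 * m + 4)%N ->
  (forall c', relation m c' -> (#|supp c'| <= 3 * m + 1)%N ->
     (rk (supp c') <= 3)%N \/ has_line (m + 2) c') ->
  (3 < rk (supp c))%N -> has_line (m + 2) c.
Proof.
move=> hc hn ih h4.
pose Q := [pred S : {set 'I_n} | (S \subset supp c) && (rk S <= 3)%N].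
have [|L /andP[Ls L3] Lmax] := @exists_max_card Q set0.
  by rewrite /= sub0set rk0.
have L3' : (3 <= #|L|)%N.
  have [|T Ts T3] := @exists_subset_card _ (supp c) 3.
    by apply: ltnW; apply: leq_trans h4 (rk_card _ _).
  rewrite -T3 Lmax // /Q /= Ts /=; apply: leq_trans (rk_card _ _) _; lia.
have [|i [p [ic hp Lp ip]]] := @separating_hyperplane _ _ _ P L (supp c).
  exact: leq_ltn_trans h4.
have hc' := relation_twist (e := 1) (m := m) hp hc.
have h5 := card_twist_zeros Ls Lp.
have sc := supp_twist_sub P c p.
have [|h6|h6] := ih _ hc'; first by lia.
  have /Lmax h7 : Q (supp (twist c p)) by rewrite /= sc h6.
  apply: (has_lineW sc); apply: (relation_has_line hc' (twist_neq0 ic ip)).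
  lia.
exact: has_lineW sc h6.
Qed.

Lemma relation_planar m c : relation m c -> (#|supp c| <= 3 * m + 1)%N ->
  (rk (supp c) <= 3)%N \/ has_line (m + 2) c.
Proof.
elim: m c => [|m ih] c hc hn.
  by left; apply: leq_trans (rk_card _ _) _; lia.
have [h3|h4] := leqP (rk (supp c)) 3; [by left | right].
apply: contraT => noline.
have short S : S \subset supp c -> (rk S <= 2)%N -> (#|S| < m + 3)%N.
  move=> h1 h2; rewrite ltnNge; apply: contra noline => h5.
  by apply/has_lineP; exists S; split=> //; lia.
have /has_lineP[L [Ls L2 Lm]] : has_line (m + 2) c.
  by apply: relation_long_line ih h4 => //; lia.
have addpt i : (rk (L :|: [set i]) <= 3)%N.
  by apply: leq_trans (rkU _ _ _) _; have := rk1 P i; lia.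
have cardadd i : i \in supp c -> i \notin L ->
    (L :|: [set i] \subset supp c) /\ (m + 3 <= #|L :|: [set i]|)%N.
  move=> ic iL; rewrite subUset Ls sub1set ic; split=> //.
  by rewrite setUC cardsU1 iL; lia.
(* [L] has exactly m + 2 points. [T] is a largest coplanar set containing [L], so its residual lies
   on a second line, disjoint from [L] in the support. *)
pose Q := [pred S : {set 'I_n} | [&& L \subset S, S \subset supp c & (rk S <= 3)%N]].
have [|T /and3P[LT Ts T3] Tmax] := @exists_max_card Q L.
  by rewrite /= subxx Ls; lia.
have Tm : (m + 3 <= #|T|)%N.
  have /subsetPn[i ic iL] : ~~ (supp c \subset L).
    by apply/negP=> /(rkS P); lia.
  have [h1 h2] := cardadd i ic iL; apply: leq_trans h2 _.
  by apply: Tmax; rewrite /= subsetUl h1 addpt.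
have [|i [p [ic hp Tp ip]]] := @separating_hyperplane _ _ _ P T (supp c).
  exact: leq_ltn_trans h4.
have hc' := relation_twist (e := 1) (m := m) hp hc.
have h5 := card_twist_zeros Ts Tp.
have h6 := relation_card hc' (twist_neq0 ic ip).
have h7 : (rk (supp (twist c p)) <= 2)%N.
  by apply: relation_collinear hc' _; lia.
have sc := supp_twist_sub P c p.
have dis : [disjoint L & supp (twist c p)].
  have Lp : L \subset zeros p by apply: subset_trans Tp.
  by rewrite supp_twist disjoint_sym disjoints_subset setDE subIset // setCS Lp orbT.
(* If the two lines were coplanar, maximality would give [T] at least 2m + 4 points; with the m + 2
   residual points this exceeds 3m + 4. *)
have h8 : (3 < rk (L :|: supp (twist c p)))%N.
  rewrite ltnNge; apply/negP=> h8.
  have /Tmax : Q (L :|: supp (twist c p)) by rewrite /= subsetUl subUset Ls sc h8.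
  by have := leq_card_setU L (supp (twist c p)); rewrite dis => -[_ /eqP];
    move: h5 h6 hn Lm Tm; clear; lia.
have [k kc'] : exists k, k \in supp (twist c p).
  by apply/set0Pn; rewrite supp_eq0 (twist_neq0 ic ip).
have kL : k \notin L by rewrite (disjointFl dis kc').
have [T's T'm] := cardadd k (subsetP sc k kc') kL.
(* A second cut, through [L] and one point [k] of the first residual, not containing the whole first
   residual. *)
have [|j [q [jc hq Tq jq]]] := @separating_hyperplane _ _ _ P (L :|: [set k])
    (L :|: supp (twist c p)); first exact: leq_ltn_trans (addpt k) h8.
have hc'' := relation_twist (e := 1) (m := m) hq hc.
have h9 := card_twist_zeros T's Tq.
have jc' : j \in supp c by move: jc; apply/subsetP; rewrite subUset Ls.
have h10 := relation_card hc'' (twist_neq0 jc' jq).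
have h11 : (rk (supp (twist c q)) <= 2)%N.
  by apply: relation_collinear hc'' _; move: h9 T'm hn; clear; lia.
set A := supp (twist c p) in kc' dis h5 h6 h7 sc h8 jc *.
set B := supp (twist c q) in h9 h10 h11.
have Bs : B \subset supp c := supp_twist_sub P c q.
have Lq : L \subset zeros q by apply: subset_trans Tq; apply: subsetUl.
have disB : [disjoint L & B].
  by rewrite /B supp_twist disjoint_sym disjoints_subset setDE subIset // setCS Lq orbT.
have hAB : (#|L| + #|A :|: B| <= #|supp c|)%N.
  have := leq_card_setU L (A :|: B).
  rewrite disjoints_subset setCU subsetI -!disjoints_subset dis disB => -[_ /eqP <-].
  by apply: subset_leq_card; rewrite !subUset Ls sc Bs.
(* The two residuals have at least m + 2 points each, but at most 2m + 2 together outside [L].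
   Sharing two points, they span the same line. *)
have hI : (1 < #|A :&: B|)%N by have := cardsUI A B; move: hAB h6 h10 hn Lm; clear; lia.
have hr : (1 < rk (A :&: B))%N.
  case/card_gt1P: hI => x [y [xI yI xy]]; apply: (rk_gt1 xI yI).
  apply: contra xy => /eqP e; apply/eqP; apply: hc.1 e.
    by apply: (subsetP sc); case/setIP: xI.
  by apply: (subsetP sc); case/setIP: yI.
have := short (A :|: B); rewrite subUset sc Bs => /(_ isT).
have -> : (rk (A :|: B) <= 2)%N by have := rkU_cap P A B; move: h7 h11 hr; clear; lia.
move=> /(_ isT).
(* The second cut removed [k] from [B], so the common line has m + 3 points, contradicting
   [short]. *)
have : (#|k |: B| <= #|A :|: B|)%N.
  by apply: subset_leq_card; rewrite setSU // sub1set.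
have -> : #|k |: B| = #|B|.+1; last by move: h10; clear; lia.
rewrite cardsU1 /B supp_twist !inE (_ : ev P q k == 0) //.
by have := subsetP Tq k; rewrite !inE eqxx orbT => /(_ isT).
Qed.
End Lines.

(** * Plane curves through points *)

Section Mask.
Variables (F : fieldType) (n : nat).
Implicit Types S : {set 'I_n}.

Definition mask_mx S : 'M[F]_n := diag_mx (\row_i (i \in S)%:R).

Lemma mul_mask_mx k (A : 'M[F]_(k, n)) S i j :
  (A *m mask_mx S) i j = A i j * (j \in S)%:R.
Proof. by rewrite mul_mx_diag !mxE. Qed.

Lemma rank_mask_mx S : (\rank (mask_mx S) <= #|S|)%N.
Proof.
have -> : mask_mx S = \sum_(i in S) delta_mx i i.
  apply/matrixP=> i j; rewrite !mxE summxE.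
  have [<-{j}|ij] := eqVneq i j; last first.
    rewrite big1 // => k _; rewrite mxE; case: (eqVneq i k) => //= <-.
    by rewrite eq_sym (negPf ij).
  rewrite mulr1n; have [iS|iS] := boolP (i \in S).
    rewrite (bigD1 i) //= mxE eqxx big1 ?addr0 // => k /andP[_ ki].
    by rewrite mxE eq_sym (negPf ki).
  rewrite big1 // => k kS; rewrite mxE; case: eqVneq => // ik.
  by rewrite ik kS in iS.
rewrite -sum1_card.
elim/big_ind2: _ => [|A a B b ha hb|i _]; first by rewrite mxrank0.
  exact: leq_trans (mxrank_add _ _) (leq_add ha hb).
by rewrite mxrank_delta.
Qed.

Lemma rank_masked k (A : 'M[F]_(k, n)) S :
  (forall i j, j \notin S -> A i j = 0) -> (\rank A <= #|S|)%N.
Proof.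
move=> hA; have -> : A = A *m mask_mx S.
  apply/matrixP=> i j; rewrite mul_mask_mx.
  by case: (boolP (j \in S)) => [_|/hA ->]; rewrite ?mulr1 ?mul0r.
exact: leq_trans (mxrankM_maxr _ _) (rank_mask_mx S).
Qed.

End Mask.

Section Curves.
Variables (F : fieldType) (r n : nat) (P : 'I_n -> 'rV[F]_r).
Implicit Types (p q : {mpoly F[r]}) (S T : {set 'I_n}).
Local Notation zeros := (zeros P).

Definition on_curve k S : Prop :=
  exists f, [/\ f != 0, (msize f <= k.+1)%N & S \subset zeros f].

Lemma on_curveM k1 k2 S p : p != 0 -> (msize p <= k1.+1)%N ->
  on_curve k2 (S :\: zeros p) -> on_curve (k1 + k2) S.
Proof.
move=> p0 hp [q [q0 hq sq]]; exists (p * q); split.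
- by rewrite mulf_neq0.
- exact: msizeM_leq.
- by rewrite zerosM -subDset.
Qed.

(** Its left kernel consists of the coefficient vectors of combinations of the monomials in [s] that
    vanish on [S]. *)
Definition mon_mx (s : seq 'X_{1..r}) S : 'M[F]_(size s, n) :=
  \matrix_(k, i) ((i \in S)%:R * ev P 'X_[tnth (in_tuple s) k] i).

Lemma rank_mon_mx_lt k (s : seq 'X_{1..r}) S :
  uniq s -> all (fun m => mdeg m <= k)%N s ->
  (\rank (mon_mx s S) < size s)%N -> on_curve k S.
Proof.
move=> us hs hr.
have /rowV0Pn[v vk v0] : kermx (mon_mx s S) != 0.
  by rewrite -mxrank_eq0 mxrank_ker; lia.
have /sub_kermxP vM := vk.
have c0 a : (\sum_b v 0 b *: 'X_[tnth (in_tuple s) b] : {mpoly F[r]})@_(tnth (in_tuple s) a)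
    = v 0 a.
  rewrite raddf_sum (bigD1 a) //= mcoeffZ mcoeffX eqxx mulr1 big1 ?addr0 //.
  move=> b ba; rewrite mcoeffZ mcoeffX (inj_eq (@tuple_uniqP _ _ (in_tuple s) us)).
  by rewrite (negPf ba) mulr0.
exists (\sum_b v 0 b *: 'X_[tnth (in_tuple s) b]); split.
- apply: contra v0 => /eqP e; apply/eqP/rowP=> a.
  by rewrite -c0 e mcoeff0 mxE.
- apply: leq_trans (msize_sum _ _ _) _; apply/bigmax_leqP=> b _.
  apply: leq_trans (msizeZ_le _ _) _; rewrite msizeX ltnS.
  by have /allP/(_ _ (mem_tnth b (in_tuple s))) := hs.
apply/subsetP=> i iS; rewrite inE; apply/eqP.
have /rowP/(_ i) := vM; rewrite !mxE => <-.
rewrite /ev raddf_sum; apply: eq_bigr => b _.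
by rewrite /= mevalZ mxE iS mul1r.
Qed.

End Curves.

Definition mon2 (a b : nat) : 'X_{1..2} := [multinom (if i == ord0 then a else b) | i < 2].

Lemma mon2_inj : injective (fun ab : nat * nat => mon2 ab.1 ab.2).
Proof.
move=> [a b] [a' b'] /mnmP h.
by have := h 0; have := h 1; rewrite !mnmE /= => -> ->.
Qed.

Lemma mdeg_mon2 a b : mdeg (mon2 a b) = (a + b)%N.
Proof. by rewrite mdegE big_ord_recl big_ord1 !mnmE. Qed.

Lemma mon2_eta (m : 'X_{1..2}) : m = mon2 (m 0) (m 1).
Proof.
apply/mnmP=> i; rewrite mnmE; case: eqVneq => [->//|i0]; congr (m _).
by apply/val_inj; case: i i0 => -[|[|]].
Qed.

(** The list has (e + 1)(e + 2)/2 entries, whence the thresholds 6 for conics and 10 for cubics. *)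
Definition mons2 e : seq 'X_{1..2} :=
  [seq mon2 ab.1 ab.2 | ab <- [seq (a - i, i)%N | a <- iota 0 e.+1, i <- iota 0 a.+1]].

Lemma mons2_deg e : all (fun m => mdeg m <= e)%N (mons2 e).
Proof.
apply/allP=> _ /mapP[_ /allpairsPdep[a [i [ha hi ->]]] ->].
by rewrite mdeg_mon2 /=; move: ha hi; rewrite !mem_iota; lia.
Qed.

(** * Lines and conics through planar supports *)

Section Plane.
Variables (F : fieldType) (n : nat) (P : 'I_n -> 'rV[F]_2).
Implicit Types (c : 'rV[F]_n) (p q : {mpoly F[2]}) (S T : {set 'I_n}).
Local Notation rk := (rk P).
Local Notation zeros := (zeros P).
Local Notation twist := (twist P).
Local Notation relation := (relation P).
Local Notation has_line := (has_line P).
Local Notation on_curve := (on_curve P).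

Lemma on_conic_rank S : (\rank (mon_mx P (mons2 2) S) < 6)%N -> on_curve 2 S.
Proof.
by apply: rank_mon_mx_lt; rewrite ?mons2_deg // (map_inj_uniq mon2_inj).
Qed.

Lemma on_cubic_rank S : (\rank (mon_mx P (mons2 3) S) < 10)%N -> on_curve 3 S.
Proof.
by apply: rank_mon_mx_lt; rewrite ?mons2_deg // (map_inj_uniq mon2_inj).
Qed.

Lemma on_conic_small S : (#|S| <= 5)%N -> on_curve 2 S.
Proof.
move=> hS; apply: on_conic_rank; apply: (@leq_ltn_trans #|S|) => //.
by apply: rank_masked => k i iS; rewrite mxE (negPf iS) mul0r.
Qed.

Lemma on_line S : (rk S <= 2)%N -> on_curve 1 S.
Proof.
move=> hS; have : (cokermx (hspan P S)) != 0.
  by rewrite -mxrank_eq0 mxrank_coker subn_eq0 -ltnNge; apply: hS.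
case/matrix0Pn=> i [j hij].
exists (linpoly (col j (cokermx (hspan P S)))); split.
- by apply: linpoly_neq0; apply/matrix0Pn; exists i, 0; rewrite mxE.
- exact: msize_linpoly.
apply/subsetP=> l lS; have := hpt_hspan P lS; rewrite submxE => /eqP h.
by rewrite inE /ev meval_linpoly colE mulmxA -/(hpt P l) h mul0mx mxE.
Qed.

Definition has_conic k c : Prop :=
  exists f, [/\ f != 0, (msize f <= 3)%N & (k <= #|supp c :&: zeros f|)%N].

(** With 2m + 2 points and m at least 2, take a conic through five of them. The points off it carry
    a relation of degree m - 2, so they are collinear and number at least m. The residual of [c] by
    their line is collinear too, and the support lies on two lines. *)
Lemma relation_conic m c : relation m c -> c != 0 -> (#|supp c| <= 2 * m + 2)%N ->
  has_line (m + 2) c \/ #|supp c| = (2 * m + 2)%N /\ on_curve 2 (supp c).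
Proof.
move=> hc c0 hn.
have [h1|h1] := leqP #|supp c| (2 * m + 1).
  by left; apply: relation_has_line hc c0 h1.
have e : #|supp c| = (2 * m + 2)%N by lia.
right; split=> //.
case: m hc e {hn h1} => [|[|m]] hc e; [by apply: on_conic_small; rewrite e..|].
have [|T Ts T5] := @exists_subset_card _ (supp c) 5; first by lia.
have [|f [f0 hf Tf]] := @on_conic_small T; first by rewrite T5.
have hc' := relation_twist (e := 2) (m := m) hf hc.
have h5 := card_twist_zeros Ts Tf.
have [/eqP c'0|c'0] := boolP (twist c f == 0).
  by exists f; split=> //; rewrite -(twist_eq0 P); apply/eqP.
have h6 := relation_card hc' c'0.
have [|g [g0 hg sg]] := @on_line (supp (twist c f)).
  by apply: relation_collinear hc' _; lia.
have hd := relation_twist (e := 1) (m := m.+1) hg hc.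
have h7 := card_twist_zeros (supp_twist_sub P c f) sg.
apply: (@on_curveM _ _ _ _ 1 1 _ g) => //; rewrite -supp_twist.
by apply: on_line; apply: relation_collinear hd _; lia.
Qed.

Lemma supp_on_conic m c : relation m c -> c != 0 -> on_curve 2 (supp c) ->
  has_line (m + 2) c \/ has_conic (2 * m + 2) c.
Proof.
move=> hc c0 [f [f0 hf sf]].
have [h1|h1] := leqP #|supp c| (2 * m + 1).
  by left; apply: relation_has_line hc c0 h1.
by right; exists f; split=> //; rewrite (setIidPl sf); lia.
Qed.

(** Off the line through [S] there remain at most 2m + 2 points in degree m. If m + 2 of them are
    collinear, cutting by that second line leaves a collinear set, so the support lies on two lines.
    Otherwise they are 2m + 2 points of a conic, which together with the first line forms a
    cubic. *)
Lemma line_residual m c S : relation m.+1 c -> c != 0 -> (#|supp c| <= 3 * m.+1)%N ->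
  S \subset supp c -> (rk S <= 2)%N -> (m.+1 <= #|S|)%N ->
  [\/ has_line (m.+1 + 2) c, has_conic (2 * m.+1 + 2) c
    | #|supp c| = (3 * m.+1)%N /\ on_curve 3 (supp c)].
Proof.
move=> hc c0 hn Ss S2 Sm.
have conicE : on_curve 2 (supp c) ->
  [\/ has_line (m.+1 + 2) c, has_conic (2 * m.+1 + 2) c
    | #|supp c| = (3 * m.+1)%N /\ on_curve 3 (supp c)].
  by case/(supp_on_conic hc c0) => ?; [apply: Or31 | apply: Or32].
have [g [g0 hg sg]] := on_line S2.
have hc' := relation_twist (e := 1) (m := m) hg hc.
have h5 := card_twist_zeros Ss sg.
have [/eqP c'0|c'0] := boolP (twist c g == 0).
  apply: conicE; exists g; split=> //; first exact: leq_trans hg _.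
  by rewrite -(twist_eq0 P); apply/eqP.
have [|/has_lineP[T [Ts T2 Tm]]|[h6 h7]] := relation_conic hc' c'0; first by lia.
  have Ts' := subset_trans Ts (supp_twist_sub P c g).
  have [f [f0 hf sf]] := on_line T2.
  have hd := relation_twist (e := 1) (m := m) hf hc.
  have h6 := card_twist_zeros Ts' sf.
  apply: conicE; apply: (@on_curveM _ _ _ _ 1 1 _ f) => //; rewrite -supp_twist.
  by apply: on_line; apply: relation_collinear hd _; lia.
apply: Or33; split; first by lia.
by apply: (@on_curveM _ _ _ _ 1 2 _ g) => //; rewrite -supp_twist.
Qed.

(** The points off the conic are collinear and, if there are any, number at least m + 2, exactly
    what [line_residual] asks for in degree m + 2. *)
Lemma conic_residual m c f : relation m.+2 c -> c != 0 -> (#|supp c| <= 3 * m.+2)%N ->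
  f != 0 -> (msize f <= 3)%N -> (#|supp (twist c f)| <= 2 * m + 1)%N ->
  [\/ has_line (m.+2 + 2) c, has_conic (2 * m.+2 + 2) c
    | #|supp c| = (3 * m.+2)%N /\ on_curve 3 (supp c)].
Proof.
move=> hc c0 hn f0 hf hr.
have hc' := relation_twist (e := 2) (m := m) hf hc.
have [/eqP c'0|c'0] := boolP (twist c f == 0).
  have [|?|?] := supp_on_conic hc c0; [|by apply: Or31|by apply: Or32].
  by exists f; split=> //; rewrite -(twist_eq0 P); apply/eqP.
apply: line_residual hc c0 hn (supp_twist_sub P c f) _ _.
  exact: relation_collinear hc' hr.
by have := relation_card hc' c'0; lia.
Qed.

End Plane.

(** * Hilbert functions of plane point sets *)

(** Terms before [j0] are compared in place and terms after it with their left neighbour; the zero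
    at [j0] absorbs the extra term. *)
Lemma leq_sum_shift (J J' : nat -> nat) e j0 : (j0 <= e)%N -> J' j0 = 0%N ->
  (forall j, j <= e -> J' j <= J j)%N -> (forall j, j <= e -> J' j.+1 <= J j)%N ->
  (\sum_(0 <= j < e.+2) J' j <= \sum_(0 <= j < e.+1) J j)%N.
Proof.
move=> h0 z h1 h2.
rewrite (@big_cat_nat _ _ _ j0) //=; last by lia.
rewrite [leqRHS](@big_cat_nat _ _ _ j0) //=; last by lia.
rewrite (@big_ltn _ _ _ j0); last by lia.
rewrite z add0n big_add1 /=; apply: leq_add; rewrite big_nat_cond [leqRHS]big_nat_cond;
  apply: leq_sum => j /andP[/andP[? ?] _]; [apply: h1|apply: h2]; lia.
Qed.

Lemma lift0_ord2 : lift ord0 ord0 = 1 :> 'I_2.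
Proof. exact/val_inj. Qed.

Section Hilbert.
Variables (F : fieldType) (n : nat) (P : 'I_n -> 'rV[F]_2) (S : {set 'I_n}).

Definition mono_row (a b : nat) : 'rV[F]_n :=
  \row_i ((i \in S)%:R * (P i 0 0 ^+ a * P i 0 1 ^+ b)).
Local Notation w := mono_row.

(** Spanned by the monomials of degree strictly below [e], hence the shift in [hilb]. *)
Definition deg_space e : 'M[F]_n :=
  (\sum_(a < e) \sum_(i < a.+1) <<w (a - i) i>>)%MS.

Definition lex_space e j : 'M[F]_n :=
  (deg_space e + \sum_(i < j) <<w (e - i) i>>)%MS.

(** The monomial is independent on [S] of those preceding it in the graded order: it is a standard
    monomial, not a leading monomial of the ideal of [S]. *)
Definition jump e j : bool := ~~ (w (e - j) j <= lex_space e j)%MS.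

Definition hilb e : nat := \rank (deg_space e.+1).

Definition delta e : nat := \sum_(0 <= j < e.+1) jump e j.

Lemma lex_space_mem e j a i : (i <= a)%N -> (a < e)%N || (a == e) && (i < j)%N ->
  (w (a - i) i <= lex_space e j)%MS.
Proof.
rewrite -ltnS => ia /orP[ae|/andP[/eqP <- ij]].
  apply: submx_trans (addsmxSl _ _); apply: (sumsmx_sup (Ordinal ae)) => //.
  by apply: (sumsmx_sup (Ordinal ia)); rewrite ?genmxE.
apply: submx_trans (addsmxSr _ _).
by apply: (sumsmx_sup (Ordinal ij)); rewrite ?genmxE.
Qed.

Lemma lex_space_sub e j k (B : 'M[F]_(k, n)) : (j <= e.+1)%N ->
  (forall a i, (i <= a)%N -> (a < e)%N || (a == e) && (i < j)%N ->
     (w (a - i) i <= B)%MS) ->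
  (lex_space e j <= B)%MS.
Proof.
move=> je h; rewrite addsmx_sub; apply/andP; split.
  apply/sumsmx_subP=> a _; apply/sumsmx_subP=> i _; rewrite genmxE.
  by apply: h; rewrite ?ltn_ord // -ltnS.
apply/sumsmx_subP=> i _; rewrite genmxE; apply: h; last by rewrite eqxx ltn_ord orbT.
by have := ltn_ord i; lia.
Qed.

Lemma deg_spaceS e : deg_space e.+1 = lex_space e e.+1.
Proof. by rewrite /deg_space big_ord_recr. Qed.

Lemma deg_space_mem e a b : (a + b <= e)%N -> (w a b <= deg_space e.+1)%MS.
Proof.
move=> h; rewrite deg_spaceS -{1}(addnK b a).
by apply: lex_space_mem; rewrite ?leq_addl //; lia.
Qed.

Lemma deg_space_sub e k (B : 'M[F]_(k, n)) :
  (forall a b, (a + b <= e)%N -> (w a b <= B)%MS) -> (deg_space e.+1 <= B)%MS.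
Proof.
move=> h; rewrite deg_spaceS; apply: lex_space_sub => // a i ia hh.
by apply: h; lia.
Qed.

Lemma rank_lex_space e j :
  \rank (lex_space e j) = (\rank (deg_space e) + \sum_(0 <= i < j) jump e i)%N.
Proof.
elim: j => [|j ih]; first by rewrite /lex_space big_ord0 addsmx0 big_geq ?addn0.
rewrite big_nat_recr //= addnA -ih.
have -> : lex_space e j.+1 = (lex_space e j + <<w (e - j) j>>)%MS.
  by rewrite /lex_space big_ord_recr /= addsmxA.
rewrite /jump; have [h|h] := boolP (_ <= _)%MS.
  rewrite addn0; apply: anti_leq; apply/andP; split; apply: mxrankS.
    by rewrite addsmx_sub submx_refl genmxE.
  exact: addsmxSl.
apply: anti_leq; apply/andP; split.
  apply: leq_trans (mxrank_adds_leqif _ _) _; rewrite leq_add2l mxrank_gen.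
  exact: rank_leq_row.
rewrite addn1; apply: rank_ltmx; rewrite /ltmx addsmxSl addsmx_sub submx_refl /=.
by rewrite genmxE.
Qed.

Lemma hilbS e : hilb e.+1 = (hilb e + delta e.+1)%N.
Proof. by rewrite /hilb {1}deg_spaceS rank_lex_space. Qed.

Lemma delta_le e : (delta e <= e.+1)%N.
Proof.
apply: (@leq_trans (\sum_(0 <= j < e.+1) 1)).
  by apply: leq_sum => i _; case: jump.
by rewrite sum_nat_const_nat subn0 muln1.
Qed.

Lemma lex_space_mul e j e' j' (x : 'rV[F]_n) : (j <= e.+1)%N ->
  (forall a i, (i <= a)%N -> (a < e)%N || (a == e) && (i < j)%N ->
     (w (a - i) i *m diag_mx x <= lex_space e' j')%MS) ->
  (lex_space e j *m diag_mx x <= lex_space e' j')%MS.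
Proof.
move=> je h; rewrite submxE -mulmxA; apply/eqP/sub_kermxP.
apply: lex_space_sub => // a i ia hh; apply/sub_kermxP.
by apply/eqP; rewrite mulmxA -submxE h.
Qed.

Lemma mono_rowX a b : w a b *m diag_mx (\row_i P i 0 0) = w a.+1 b.
Proof.
by apply/rowP=> i; rewrite mul_mx_diag !mxE exprSr -!mulrA; congr (_ * (_ * _)); rewrite mulrC.
Qed.

Lemma mono_rowY a b : w a b *m diag_mx (\row_i P i 0 1) = w a b.+1.
Proof. by apply/rowP=> i; rewrite mul_mx_diag !mxE exprSr !mulrA. Qed.

(** Multiplication by a variable respects the monomial order, so it carries leading monomials of the
    ideal to leading monomials. *)
Lemma jumpX e j : (j <= e)%N -> jump e.+1 j -> jump e j.
Proof.
move=> je; apply: contra => h; rewrite subSn // -mono_rowX.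
apply: submx_trans (submxMr _ h) _; apply: lex_space_mul => [|a i ia ha].
  by lia.
by rewrite mono_rowX -subSn //; apply: lex_space_mem; lia.
Qed.

Lemma jumpY e j : (j <= e)%N -> jump e.+1 j.+1 -> jump e j.
Proof.
move=> je; apply: contra => h; rewrite subSS -mono_rowY.
apply: submx_trans (submxMr _ h) _; apply: lex_space_mul => [|a i ia ha].
  by lia.
by rewrite mono_rowY -subSS; apply: lex_space_mem; lia.
Qed.

(* Multiplying the non-jumps of degree e, i.e. the leading monomials of the
   ideal of S, by both variables gives at least one more non-jump in degree
   e + 1, while the number of monomials grows by exactly one. *)
Lemma delta_noninc e : (delta e <= e)%N -> (delta e.+1 <= delta e)%N.
Proof.
move=> he; have [j0 j0e hj0] : exists2 j, (j <= e)%N & ~~ jump e j.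
  have [/existsP[j hj]|/existsPn hn] := boolP [exists j : 'I_e.+1, ~~ jump e j].
    by exists j => //; rewrite -ltnS.
  move: he; rewrite /delta big_mkord (eq_bigr (fun=> 1%N)) => [|i _].
    by rewrite sum_nat_const card_ord muln1 ltnn.
  by have := hn i; rewrite negbK => ->.
apply: (leq_sum_shift j0e) => [|j je|j je].
- by apply/eqP; rewrite eqb0; apply: contra hj0; apply: jumpX.
- by have := jumpX je; case: jump => // ->.
- by have := jumpY je; case: jump => // ->.
Qed.

(** From degree 2 on, a value at most 2 is below the generic one, so [delta_noninc] keeps
    applying. *)
Lemma delta_le2 e k : (2 <= e)%N -> (delta e <= 2)%N -> (delta (e + k) <= 2)%N.
Proof.
move=> e2 h; elim: k => [|k ih]; first by rewrite addn0.
by rewrite addnS; apply: leq_trans (delta_noninc _) (ih); lia.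
Qed.

(** By [delta_le2], a difference above 2 in a later degree forces every earlier difference from
    degree 2 on to be at least 3. *)
Lemma hilb_growth e k l : (1 <= e)%N -> (2 < delta (e + k + l))%N -> (0 < l)%N ->
  (hilb e + 3 * k <= hilb (e + k))%N.
Proof.
move=> e1 + l0; elim: k l l0 => [|k ih] l l0 hd; first by rewrite muln0 !addn0.
have := ih l.+1 isT; rewrite addnS -addSn -addnS => /(_ hd) h1.
have : (2 < delta (e + k.+1))%N.
  rewrite ltnNge; apply/negP => hle; move: hd.
  by rewrite ltnNge delta_le2 //; lia.
by rewrite addnS hilbS; lia.
Qed.

Lemma mon_mxE (s : seq 'X_{1..2}) k :
  row k (mon_mx P s S) = w (tnth (in_tuple s) k 0) (tnth (in_tuple s) k 1).
Proof.
apply/rowP=> i; rewrite !mxE; congr (_ * _).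
by rewrite /ev mevalX big_ord_recl big_ord1 lift0_ord2.
Qed.

Lemma rank_mon_hilb e : (\rank (mon_mx P (mons2 e) S) <= hilb e)%N.
Proof.
apply: mxrankS; apply/row_subP=> k; rewrite mon_mxE; apply: deg_space_mem.
have /allP/(_ _ (mem_tnth k (in_tuple (mons2 e)))) := mons2_deg e.
by rewrite /= {1}(mon2_eta (tnth _ _)) mdeg_mon2.
Qed.

Lemma relation_mono m v : {in supp v &, injective P} -> supp v \subset S ->
  (forall a b, (a + b <= m)%N -> \sum_i v 0 i * w a b 0 i = 0) ->
  relation P m v.
Proof.
move=> inj sv h; split=> // p hp.
under eq_bigr do rewrite /ev mevalE mulr_sumr.
rewrite exchange_big /= big_seq big1 // => mm hm.
have hd : (mm 0%R + mm 1%R <= m)%N.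
  rewrite -mdeg_mon2 -mon2_eta -ltnS.
  by apply: leq_trans hp; apply: msize_mdeg_lt.
rewrite (eq_bigr (fun i => p@_mm * (v 0 i * w (mm 0%R) (mm 1%R) 0 i))).
  by rewrite -mulr_sumr h // mulr0.
move=> i _; rewrite mulrCA; congr (_ * _).
have [->|vi] := eqVneq (v 0 i) 0; first by rewrite !mul0r.
congr (_ * _); rewrite mxE (subsetP sv) ?inE // mul1r.
by rewrite big_ord_recl big_ord1 lift0_ord2.
Qed.

(** Dimension count: vectors supported on [S] minus [Z] satisfy at most [hilb e] independent
    conditions. This yields a relation on fewer points. *)
Lemma exists_relation e (Z : {set 'I_n}) : {in S &, injective P} -> Z \subset S ->
  (hilb e + #|Z| < #|S|)%N ->
  exists v, [/\ v != 0, supp v \subset S :\: Z & relation P e v].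
Proof.
move=> inj ZS hh; set V := kermx (deg_space e.+1)^T.
set B := mask_mx F (~: (S :\: Z)).
have : (V :&: kermx B)%MS != 0.
  rewrite -mxrank_eq0 -lt0n.
  have e1 : \rank V = (n - hilb e)%N by rewrite mxrank_ker mxrank_tr.
  have e2 := mxrank_mul_ker V B.
  have e3 := leq_trans (mxrankM_maxr V B) (rank_mask_mx F (~: (S :\: Z))).
  have e4 := cardsC (S :\: Z); rewrite card_ord in e4.
  have e5 : (#|S :\: Z| = #|S| - #|Z|)%N by rewrite cardsD (setIidPr ZS).
  by move: e1 e2 e3 e4 e5 hh; clear; lia.
case/rowV0Pn=> v; rewrite sub_capmx => /andP[/sub_kermxP vV /sub_kermxP vB] v0.
have sv : supp v \subset S :\: Z.
  apply/subsetP=> i; rewrite inE; apply: contraR => iS.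
  have /rowP/(_ i) := vB; rewrite mul_mask_mx inE iS mulr1 => ->.
  by rewrite mxE.
have svS : supp v \subset S by apply: subset_trans sv (subsetDl _ _).
exists v; split=> //; apply: relation_mono => //.
  by move=> i j hi hj; apply: inj; apply: (subsetP svS).
move=> a b hab; have /submxP[D hD] := deg_space_mem hab.
have : v *m (w a b)^T = 0 by rewrite hD trmx_mul mulmxA vV mul0mx.
move/matrixP/(_ 0 0); rewrite !mxE => h; rewrite -[RHS]h.
by apply: eq_bigr => i _; rewrite !mxE.
Qed.

End Hilbert.

Lemma rank_mul_diag_supp (F : fieldType) n k (c : 'rV[F]_n) (A : 'M[F]_(k, n)) :
  (forall i j, j \notin supp c -> A i j = 0) ->
  (\rank A <= \rank (A *m diag_mx c))%N.
Proof.
(* Off the support the inverse is 0 by convention, harmless since those columns of [A] vanish. *)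
move=> h; have {1}-> : A = A *m diag_mx c *m diag_mx (\row_i (c 0 i)^-1).
  apply/matrixP=> i j; rewrite !mul_mx_diag !mxE.
  have [/eqP cj|cj] := boolP (c 0 j == 0); last by rewrite mulfK.
  by rewrite h ?mul0r // inE cj eqxx.
exact: mxrankM_maxl.
Qed.

(** The form with matrix [diag_mx c] is nondegenerate on the support, and the values of polynomials
    of degrees at most k and m are orthogonal for it. The Frobenius rank inequality bounds the sum
    of their dimensions. *)
Lemma hilb_symm (F : fieldType) n (P : 'I_n -> 'rV[F]_2) k m c :
  relation P (k + m) c ->
  (\rank (mon_mx P (mons2 k) (supp c)) + hilb P (supp c) m <= #|supp c|)%N.
Proof.
move=> hc; set S := supp c; set M := mon_mx P _ S.
have hM : (\rank M <= \rank (M *m diag_mx c))%N.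
  by apply: rank_mul_diag_supp => i j jS; rewrite mxE (negPf jS) mul0r.
have hU : (hilb P S m <= \rank (deg_space P S m.+1 *m diag_mx c))%N.
  apply: rank_mul_diag_supp => i j jS.
  suff : (deg_space P S m.+1 <= mask_mx F S)%MS.
    move/(row_subP)/(_ i)/submxP=> [D] /rowP/(_ j); rewrite mul_mask_mx mxE => ->.
    by rewrite (negPf jS) mulr0.
  apply: deg_space_sub => a b _; apply/submxP; exists (mono_row P S a b).
  apply/rowP=> l; rewrite mul_mask_mx !mxE.
  by case: (l \in S); rewrite /= ?mul1r ?mulr1 ?mulr0 ?mul0r.
have := mxrank_Frobenius (deg_space P S m.+1) (diag_mx c) M^T.
have -> : deg_space P S m.+1 *m diag_mx c *m M^T = 0.
  rewrite -mulmxA; apply/sub_kermxP; apply: deg_space_sub => a b hab.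
  apply/sub_kermxP/rowP=> l; rewrite mulmxA !mxE.
  set mm := tnth (in_tuple (mons2 k)) l.
  have hm : (mdeg mm <= k)%N.
    by have /allP/(_ _ (mem_tnth l (in_tuple (mons2 k)))) := mons2_deg k.
  rewrite -[RHS](hc.2 'X_[(mon2 a b + mm)%MM]); last first.
    by rewrite msizeX mdegD mdeg_mon2 ltnS addnC leq_add.
  apply: eq_bigr => i _; rewrite mul_mx_diag !mxE -/mm.
  rewrite mpolyXD evM [ev P 'X_[mon2 a b] i]/ev mevalX big_ord_recl big_ord1.
  rewrite lift0_ord2 !mnmE /=.
  have [iS|] := boolP (i \in S); first by rewrite !mul1r mulrAC mulrC !mulrA.
  by rewrite inE negbK => /eqP ->; rewrite mulr0 !mul0r.
have : (\rank (diag_mx c) <= #|S|)%N.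
  apply: rank_masked => i j; rewrite inE negbK => /eqP h; rewrite !mxE.
  by case: eqVneq => // ->; rewrite h.
rewrite mxrank0 addn0 -[\rank (diag_mx c *m M^T)]mxrank_tr trmx_mul trmxK tr_diag_mx.
move=> h1 h2; rewrite addnC.
exact: leq_trans (leq_add hU hM) (leq_trans h2 h1).
Qed.

(** * Plane cubics *)

Section PlaneCubics.
Variables (F : fieldType) (n : nat) (P : 'I_n -> 'rV[F]_2).
Implicit Types (c v : 'rV[F]_n).
Local Notation relation := (relation P).
Local Notation has_line := (has_line P).
Local Notation has_conic := (has_conic P).
Local Notation on_curve := (on_curve P).

(** A line or conic found for a relation of degree m on fewer points is used to cut [c]. For a conic
    at most m + 1 points remain, within the bound 2(m - 1) + 1 since m is at least 2. *)
Lemma subrelation_residual m c v : (2 <= m)%N -> relation m.+1 c -> c != 0 ->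
  (#|supp c| <= 3 * m.+1)%N -> supp v \subset supp c ->
  has_line (m + 2) v \/ has_conic (2 * m + 2) v ->
  [\/ has_line (m.+1 + 2) c, has_conic (2 * m.+1 + 2) c
    | #|supp c| = (3 * m.+1)%N /\ on_curve 3 (supp c)].
Proof.
move=> m2 hc c0 hn sv [/has_lineP[S [Ss S2 Sm]]|[f [f0 hf sf]]].
  by apply: line_residual hc c0 hn (subset_trans Ss sv) S2 _; lia.
case: m m2 hc hn sf => // m m2 hc hn sf.
apply: (conic_residual hc c0 hn f0 hf).
have := card_twist P c f.
have : (#|supp v :&: zeros P f| <= #|supp c :&: zeros P f|)%N.
  by apply: subset_leq_card; apply: setSI.
by move: sf hn m2; clear; lia.
Qed.

Lemma small_relation m c : relation m c -> c != 0 -> (#|supp c| <= 2 * m + 2)%N ->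
  has_line (m + 2) c \/ has_conic (2 * m + 2) c.
Proof.
move=> hc c0 hn; have [h|[e [f [f0 hf sf]]]] := relation_conic hc c0 hn; first by left.
by right; exists f; split=> //; rewrite (setIidPl sf) e.
Qed.

Lemma relation_lt_cubic m c : relation m c -> c != 0 -> (#|supp c| < 3 * m)%N ->
  has_line (m + 2) c \/ has_conic (2 * m + 2) c.
Proof.
elim: m c => [//|m ih] c hc c0 hn.
have [m3|m3] := ltnP m 3.
  by apply: small_relation hc c0 _; move: hn m3; clear; lia.
have sub v : v != 0 -> supp v \subset supp c -> relation m v -> (#|supp v| < 3 * m)%N ->
    has_line (m.+1 + 2) c \/ has_conic (2 * m.+1 + 2) c.
  move=> v0 sv hv nv; have := ih v hv v0 nv.
  case/(subrelation_residual (ltnW m3) hc c0 (ltnW hn) sv) => [|//|[h _]]; auto.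
  by move: h hn; clear; lia.
have [h6|h6] := ltnP (\rank (mon_mx P (mons2 2) (supp c))) 6.
  exact: supp_on_conic hc c0 (on_conic_rank h6).
have [hs|hs] := ltnP #|supp c| (3 * m).
  by apply: (sub c) => //; apply: relationW hc.
set h := hilb P (supp c).
have h2 : (6 <= h 2)%N by apply: leq_trans (rank_mon_hilb _ _ _).
have hm : (6 + h m.-1 <= #|supp c|)%N.
  have em : (2 + m.-1)%N = m.+1 by move: m3; clear; lia.
  rewrite -em in hc; apply: leq_trans (hilb_symm hc).
  by rewrite leq_add2r.
(* Removing [Z] leaves 3m - 1 points, few enough for the induction hypothesis. *)
have [|Z Zs Zn] := @exists_subset_card _ (supp c) (#|supp c| - (3 * m - 1)).
  by rewrite leq_subr.
have [hz|hz] := ltnP (h m + #|Z|) #|supp c|.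
  have [v [v0 sv hv]] := exists_relation hc.1 Zs hz.
  apply: (sub v) => //; first exact: subset_trans sv (subsetDl _ _).
  apply: leq_ltn_trans (subset_leq_card sv) _; rewrite cardsD (setIidPr Zs) Zn.
  by move: hs m3; clear; lia.
(* Here h(m) is at least 3m - 1, while symmetry gives h(m - 1) at most 3m - 4. Growth by 3 per
   degree from h(2) at least 6 would then make h(m - 1) at least 3m - 3. *)
have hd : (2 < delta P (supp c) m)%N.
  have := hilbS P (supp c) m.-1; rewrite prednK ?(ltnW (ltnW m3)) // -/h => e.
  by move: e hz Zn hs hm hn m3; clear; lia.
have := @hilb_growth _ _ P (supp c) 2 (m - 3) 1 isT.
rewrite (_ : (2 + (m - 3) + 1)%N = m); last by move: m3; clear; lia.
rewrite (_ : (2 + (m - 3))%N = m.-1); last by move: m3; clear; lia.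
move=> /(_ hd isT); rewrite -/h => hg.
by exfalso; move: hg h2 hm hn m3; clear; lia.
Qed.

Lemma relation_cubic m c : relation m c -> c != 0 -> (#|supp c| <= 3 * m)%N ->
  [\/ has_line (m + 2) c, has_conic (2 * m + 2) c
    | #|supp c| = (3 * m)%N /\ on_curve 3 (supp c)].
Proof.
move=> hc c0 hn.
have [h|h] := ltnP #|supp c| (3 * m).
  by case: (relation_lt_cubic hc c0 h) => ?; [apply: Or31|apply: Or32].
have {}hn : #|supp c| = (3 * m)%N by apply: anti_leq; rewrite hn.
have [m3|m3] := ltnP m 3.
  have [|?|?] := small_relation hc c0; [|by apply: Or31|by apply: Or32].
  by move: hn m3; clear; lia.
have [h10|h10] := ltnP (\rank (mon_mx P (mons2 3) (supp c))) 10.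
  by apply: Or33; split=> //; apply: on_cubic_rank.
case: m m3 hc hn {h} => // m m3 hc hn.
set h := hilb P (supp c).
(* Of 3m + 3 points, 3m - 1 remain: the largest size that [relation_lt_cubic] allows in degree m. *)
have [|Z Zs Zn] := @exists_subset_card _ (supp c) 4.
  by rewrite hn; move: m3; clear; lia.
have [hz|hz] := ltnP (h m + #|Z|) #|supp c|.
  have [v [v0 sv hv]] := exists_relation hc.1 Zs hz.
  have svc : supp v \subset supp c := subset_trans sv (subsetDl _ _).
  apply: (@subrelation_residual m c v) => //; first by rewrite hn.
  apply: relation_lt_cubic hv v0 _.
  apply: leq_ltn_trans (subset_leq_card sv) _; rewrite cardsD (setIidPr Zs) Zn hn.
  by move: m3; clear; lia.
have h3 : (10 <= h 3)%N by apply: leq_trans (rank_mon_hilb _ _ _).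
have hm : (10 + h (m - 2) <= #|supp c|)%N.
  have em : (3 + (m - 2))%N = m.+1 by move: m3; clear; lia.
  rewrite -em in hc; apply: leq_trans (hilb_symm hc).
  by rewrite leq_add2r.
have dS e := hilbS P (supp c) e; have dle e := delta_le P (supp c) e.
rewrite -/h in dS; set d := delta P (supp c) in dS dle.
have hm0 : (3 * m - 1 <= h m)%N by move: hz Zn hn; clear; lia.
(* For m from 2 to 4 the bound e + 1 on the differences already contradicts h(3) at least 10. *)
exfalso; have [m5|m5] := ltnP m 5.
  have d1 := dS 1%N; have d2 := dS 2%N; have l2 := dle 2%N; have l3 := dle 3%N.
  case: m m3 m5 hn hm {hc hz hm0} => [|[|[|[|[|//]]]]] // _ _ hn;
    rewrite !subSS subn0 hn => hm; by move: h3 hm d1 d2 l2 l3; clear; lia.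
(* Otherwise the last two differences are at most 2 and h(m) is at most (3m - 7) + 4. Growth from
   h(3) then gives h(m - 2) at least 3m - 5, against 3m - 7 from symmetry. *)
have hd : (2 < d (m - 1))%N.
  rewrite ltnNge; apply/negP=> hd.
  have := @delta_le2 _ _ P (supp c) (m - 1) 1 _ hd.
  have := dS (m - 2)%N; have := dS (m - 1)%N.
  rewrite (_ : (m - 2).+1 = (m - 1)%N); last by move: m5; clear; lia.
  rewrite (_ : (m - 1).+1 = m); last by move: m5; clear; lia.
  rewrite (_ : (m - 1 + 1)%N = m); last by move: m5; clear; lia.
  rewrite -/d => e1 e2 /(_ _) e3.
  have {}e3 : (d m <= 2)%N by apply: e3; move: m5; clear; lia.
  by move: e1 e2 e3 hd hm hm0 hn m5; clear; lia.
have := @hilb_growth _ _ P (supp c) 3 (m - 5) 1 isT.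
rewrite (_ : (3 + (m - 5) + 1)%N = (m - 1)%N); last by move: m5; clear; lia.
rewrite (_ : (3 + (m - 5))%N = (m - 2)%N); last by move: m5; clear; lia.
move=> /(_ hd isT); rewrite -/h => hg.
by move: hg h3 hm hn m5; clear; lia.
Qed.

End PlaneCubics.

(** * Affine frames and the theorem *)

Section Frames.
Variables (F : fieldType) (r n : nat) (P : 'I_n -> 'rV[F]_r).
Implicit Types (c : 'rV[F]_n) (S T : {set 'I_n}).

Lemma affine_frame k S : (k <= r)%N -> (rk P S <= k.+1)%N ->
  exists (a : 'rV[F]_r) (W : 'M[F]_(k, r)),
    row_free W /\ forall i, i \in S -> (P i - a <= W)%MS.
Proof.
move=> kr hS; have [->|[i0 i0S]] := set_0Vmem S.
  exists 0, (pid_mx k); split; first by rewrite /row_free rank_pid_mx.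
  by move=> i; rewrite inE.
(* [E] sends homogeneous coordinates to the displacement from [P i0]; it kills [hpt P i0], so the
   rank drops by at least one. *)
pose E : 'M[F]_(1 + r, r) := col_mx (- P i0) 1%:M.
have hE i : hpt P i *m E = P i - P i0.
  by rewrite mul_row_col mul1mx mulmx1 addrC.
pose N := hspan P S *m E.
have hN : (\rank N <= k)%N.
  have : (0 < \rank (hspan P S :&: kermx E))%N.
    apply: (@leq_trans (\rank (hpt P i0))).
      rewrite rank_rV lt0b; apply/eqP=> /(congr1 (@lsubmx F 1 1 r))/matrixP/(_ 0 0).
      by rewrite row_mxKl !mxE eqxx; apply/eqP; rewrite oner_eq0.
    apply: mxrankS; rewrite sub_capmx hpt_hspan //=.
    by apply/sub_kermxP; rewrite hE subrr.
  have := mxrank_mul_ker (hspan P S) E.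
  by move: hS; rewrite /rk /N; lia.
(* The first [k] rows of the extended basis of [N] are free and span a space containing [N]. *)
exists (P i0), (pid_mx k *m row_ebase N); split.
  by rewrite /row_free mxrankMfree ?row_free_unit ?row_ebase_unit // rank_pid_mx.
move=> i iS; rewrite -hE.
apply: (@submx_trans _ _ _ _ _ _ N); first exact/submxMr/hpt_hspan.
rewrite -{1}[N]mulmx_ebase.
have -> : pid_mx (\rank N) =
    (pid_mx (\rank N) : 'M_(1 + r, k)) *m (pid_mx k : 'M_(k, r)) :> 'M[F]_(1 + r, r).
  by rewrite mul_pid_mx (minn_idPl hN) (minn_idPr hN).
by rewrite -!mulmxA mulmxA; apply: submxMl.
Qed.

Lemma collinear_of_rk S : (1 <= r)%N -> (rk P S <= 2)%N -> collinear P S.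
Proof.
move=> r1 hS; have [a [W [fW hW]]] := affine_frame r1 hS.
exists a, W; split; first by rewrite -mxrank_eq0 (eqnP fW).
move=> i /hW/submxP[D hD]; exists (D 0 0).
by rewrite -mul_scalar_mx -mx11_scalar -hD addrC subrK.
Qed.

End Frames.

(** * Transport of relations to affine coordinates *)

Lemma msize_comp_linear (F : fieldType) k r (lq : k.-tuple {mpoly F[r]})
    (f : {mpoly F[k]}) :
  (forall j, msize (tnth lq j) <= 2)%N -> (msize (f \mPo lq) <= msize f)%N.
Proof.
move=> hq; rewrite comp_mpolyEX; apply: leq_trans (msize_sum _ _ _) _.
apply/bigmax_leqP_seq => m hm _; apply: leq_trans (msizeZ_le _ _) _.
apply: leq_trans (msize_mdeg_lt hm); rewrite comp_mpolyX mdegE.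
elim/big_ind2: _ => [|p a q b hp hb|j _]; first by rewrite msize1.
  exact: msizeM_leq.
elim: (m j) => [|e ih]; first by rewrite expr0 msize1.
by rewrite exprS; apply: (@msizeM_leq _ _ 1 e).
Qed.

Section Chart.
Variables (F : fieldType) (r n k : nat) (P : 'I_n -> 'rV[F]_r).
Variables (a : 'rV[F]_r) (W : 'M[F]_(k, r)).

Definition chart i : 'rV[F]_k := (P i - a) *m pinvmx W.

Lemma chartK i : (P i - a <= W)%MS -> P i = a + chart i *m W.
Proof. by move=> h; rewrite /chart mulmxKpV // addrC subrK. Qed.

(** A polynomial in the chart coordinates pulls back along affine functions to an ambient polynomial
    of no larger degree. *)
Lemma relation_chart m c : (forall i, i \in supp c -> (P i - a <= W)%MS) ->
  relation P m c -> relation chart m c.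
Proof.
move=> hW [inj h]; split.
  move=> i j hi hj e; apply: inj => //.
  by rewrite (chartK (hW i hi)) (chartK (hW j hj)) e.
move=> f hf.
pose L : 'M[F]_(1 + r, k) := col_mx (- a *m pinvmx W) (pinvmx W).
pose lq := [tuple linpoly (col j L) | j < k].
rewrite -[RHS](h (f \mPo lq)); last first.
  apply: leq_trans hf; apply: msize_comp_linear => j.
  by rewrite tnth_mktuple msize_linpoly.
apply: eq_bigr => i _; congr (_ * _); rewrite /ev comp_mpoly_meval.
apply: meval_eq => j; rewrite tnth_mktuple meval_linpoly colE mulmxA -colE.
by rewrite [RHS]mxE mul_row_col mul1mx /chart mulmxBl addrC mulNmx.
Qed.

End Chart.

Section PlaneChart.
Variables (F : fieldType) (r n : nat) (P : 'I_n -> 'rV[F]_r).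
Variables (a : 'rV[F]_r) (W : 'M[F]_(2, r)) (S : {set 'I_n}).
Hypothesis fW : row_free W.
Hypothesis hW : forall i, i \in S -> (P i - a <= W)%MS.
Local Notation Q := (chart P a W).
Implicit Types (T : {set 'I_n}) (f : {mpoly F[2]}).

Lemma collinear_chart T : T \subset S -> (rk Q T <= 2)%N -> collinear P T.
Proof.
move=> /subsetP TS hT; have [a' [b [b0 h]]] := collinear_of_rk (isT : 0 < 2)%N hT.
exists (a + a' *m W), (b *m W); split.
  by apply: contra b0 => /eqP e; apply/eqP; apply: (row_free_inj fW); rewrite e mul0mx.
move=> i iT; have [t ht] := h i iT; exists t.
by rewrite (chartK (hW (TS i iT))) ht mulmxDl addrA scalemxAl.
Qed.

Lemma chart_coords : exists u v : 'rV[F]_r, \rank (col_mx u v) = 2%N /\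
  forall i, i \in S -> P i = a + Q i 0 0 *: u + Q i 0 1 *: v.
Proof.
exists (row 0 W), (row 1 W).
have -> : col_mx (row 0 W) (row 1 W) = W.
  by apply/row_matrixP=> i; have [j ->|j ->] := @split_ordP 1 1 i;
    rewrite ?rowKu ?rowKd ord1; apply/rowP=> l; rewrite !mxE; congr (W _ _); apply/val_inj.
split; first exact/eqnP.
move=> i iS; rewrite {1}(chartK (hW iS)) -addrA; congr (_ + _).
by rewrite mulmx_sum_row big_ord_recl big_ord1 lift0_ord2.
Qed.

Lemma ev_chart f i : f.@[pt2 (Q i 0 0) (Q i 0 1)] = ev Q f i.
Proof.
apply: meval_eq => j; rewrite /pt2; case: j => -[|[|//]] h /=;
  by congr (Q i 0 _); apply/val_inj.
Qed.

Lemma on_plane_curve_chart k T f : T \subset S -> f != 0 -> (msize f <= k.+1)%N ->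
  T \subset zeros Q f -> on_plane_curve P k T.
Proof.
move=> /subsetP TS f0 hf /subsetP Tf; have [u [v [uv h]]] := chart_coords.
exists a, u, v; split=> //; exists f; do 2!split=> //.
move=> i iT; exists (Q i 0 0), (Q i 0 1); split; first exact: h (TS i iT).
by rewrite ev_chart; have := Tf i iT; rewrite inE => /eqP.
Qed.

Lemma on_plane_curves2_chart k1 k2 T f : T \subset S -> f != 0 ->
  (msize f <= k1.+1)%N -> (msize f <= k2.+1)%N ->
  T \subset zeros Q f -> on_plane_curves2 P k1 k2 T.
Proof.
move=> /subsetP TS f0 hf1 hf2 /subsetP Tf; have [u [v [uv h]]] := chart_coords.
exists a, u, v; split=> //; exists f, f; do 4!split=> //.
move=> i iT; exists (Q i 0 0), (Q i 0 1); split; first exact: h (TS i iT).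
by rewrite ev_chart; have := Tf i iT; rewrite inE => /eqP.
Qed.

End PlaneChart.

Theorem theorem1 (F : finFieldType) (r n m : nat)
    (P : 'I_n -> 'rV[F]_r) (C : {vspace 'rV[F]_n}) (d : nat) (c : 'rV[F]_n) :
  (2 <= r)%N ->
  injective P ->
  (* C = C(D,G) contains the evaluations of all polynomials of degree <= m *)
  (forall p : {mpoly F[r]}, (msize p <= m.+1)%N -> ev_poly P p \in C) ->
  (* d is the minimum distance of C^* and c is a codeword of weight d *)
  in_dual C c -> c != 0 -> weight c = d ->
  (forall c' : 'rV[F]_n, in_dual C c' -> c' != 0 -> (d <= weight c')%N) ->
  [/\ (d <= m + 2)%N -> d = (m + 2)%N /\ collinear P (supp c),
      (d <= 2 * m + 2)%N ->
        (forall T : {set 'I_n}, T \subset supp c -> #|T| = (m + 2)%N ->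
           ~ collinear P T) ->
        d = (2 * m + 2)%N /\ on_plane_curve P 2 (supp c)
    & (d <= 3 * m)%N ->
        (forall T : {set 'I_n}, T \subset supp c -> #|T| = (m + 2)%N ->
           ~ collinear P T) ->
        (forall T : {set 'I_n}, T \subset supp c -> #|T| = (2 * m + 2)%N ->
           ~ on_plane_curve P 2 T) ->
        d = (3 * m)%N /\ on_plane_curves2 P 3 m (supp c)].
Proof.
move=> r2 inj hC hc c0 hd _; rewrite /weight in hd.
have r1 : (1 <= r)%N by apply: leq_trans r2.
have hr : relation P m c.
  split=> [i j _ _|p hp]; first exact: inj.
  rewrite -[RHS](hc _ (hC p hp)); apply: eq_bigr => i _.
  by rewrite mxE.
have hcard := relation_card hr c0.
pose no_line := forall T : {set 'I_n}, T \subset supp c -> #|T| = (m + 2)%N ->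
  ~ collinear P T.
have no_lineP : no_line -> ~ has_line P (m + 2) c.
  move=> nl /has_lineP[S [Ss S2 /exists_subset_card[T TS Tm]]].
  apply: (nl T) => //; first exact: subset_trans Ss.
  by apply: collinear_of_rk r1 _; apply: leq_trans S2; apply: rkS.
have planar : no_line -> (d <= 3 * m + 1)%N -> exists a (W : 'M[F]_(2, r)),
    row_free W /\ forall i, i \in supp c -> (P i - a <= W)%MS.
  move=> /no_lineP nl dm.
  have [|h3|//] := relation_planar hr; first by rewrite hd.
  exact: affine_frame r2 h3.
have chart_line a (W : 'M[F]_(2, r)) : row_free W ->
    (forall i, i \in supp c -> (P i - a <= W)%MS) ->
    no_line -> ~ has_line (chart P a W) (m + 2) c.
  move=> fW hW nl /has_lineP[S [Ss S2 /exists_subset_card[T TS Tm]]].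
  have Tc := subset_trans TS Ss.
  apply: (nl T) => //; apply: (collinear_chart fW hW Tc).
  by apply: leq_trans S2; apply: rkS.
have part1 : (d <= m + 2)%N -> d = (m + 2)%N /\ collinear P (supp c).
  move=> dm; rewrite -hd; have e : #|supp c| = (m + 2)%N by lia.
  split=> //; apply: collinear_of_rk => //.
  (* The inequality m + 2 <= 2m + 1 fails for m = 0, where two points are collinear anyway. *)
  case: m hr e {dm hC hcard no_line no_lineP planar chart_line} => [|m] hr e.
    by apply: leq_trans (rk_card _ _) _; rewrite e.
  by apply: relation_collinear hr _; rewrite e; lia.
have part2 : (d <= 2 * m + 2)%N -> no_line ->
    d = (2 * m + 2)%N /\ on_plane_curve P 2 (supp c).
  move=> dm nl.
  have dm2 : (2 * m + 1 < d)%N.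
    rewrite ltnNge; apply/negP=> h; apply: (no_lineP nl).
    by apply: relation_has_line => //; rewrite hd.
  (* Positivity of m gives 2m + 2 <= 3m + 1, the bound needed for coplanarity. *)
  have m1 : (0 < m)%N.
    rewrite lt0n; apply/eqP=> m0; apply: (nl (supp c)) => //.
      by rewrite hd; lia.
    by apply: (proj2 (part1 _)); lia.
  have [|a [W [fW hW]]] := planar nl; first by lia.
  have := relation_conic (relation_chart hW hr) c0; rewrite hd => /(_ dm).
  case=> [/(chart_line a W fW hW nl) //|[e [f [f0 hf sf]]]].
  by split=> //; apply: (on_plane_curve_chart fW hW (f := f)).
split=> // dm nl nc.
(* For m = 0 the bound 3m contradicts d >= 2; for m = 1 it equals m + 2 and for m = 2 it equals 2m +
   2, so the first two parts contradict the assumptions. *)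
have [m3|m3] := ltnP m 3.
  have {m3} : m = 0%N \/ m = 1%N \/ m = 2%N by lia.
  case=> [e|[e|e]].
  - by exfalso; move: dm hcard; rewrite hd e; lia.
  - have [|e1 col] := part1; first by lia.
    by case: (nl (supp c)) => //; rewrite hd.
  have [|//|e1 con] := part2; first by lia.
  by case: (nc (supp c)) => //; rewrite hd.
have [|a [W [fW hW]]] := planar nl; first by lia.
have := relation_cubic (relation_chart hW hr) c0; rewrite hd => /(_ dm).
case=> [/(chart_line a W fW hW nl) //|[f [f0 hf sf]]|[e [f [f0 hf sf]]]].
  have [T Tf Tm] := exists_subset_card sf.
  have [Ts Tz] : T \subset supp c /\ T \subset zeros (chart P a W) f.
    by apply/andP; rewrite -subsetI.
  by case: (nc T Ts Tm); apply: (on_plane_curve_chart fW hW (f := f)).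
split=> //; apply: (on_plane_curves2_chart fW hW (f := f)) => //.
by apply: leq_trans hf _.
Qed.
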